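(* Let $U$ be the forgetful functor from the category $\infty\text{-}\mathbb{C}\mathbb{C}\mathrm{AT}$ of strict cubical $\infty$-categories (and strict cubical $\infty$-functors) to the category $\mathbb{C}\mathrm{Sets}$ of cubical sets, sending a strict cubical $\infty$-category to its underlying cubical set and a strict cubical $\infty$-functor to its underlying morphism of cubical sets. Then $U$ is a right adjoint (i.e. it has a left adjoint) and $U$ is monadic.
   Context: **Cubical sets.** A cubical set is a family of sets $(C_n)_{n\ge 0}$ with maps (sources and targets) $s^n_{n-1,j},t^n_{n-1,j}:C_n\to C_{n-1}$ for $n\ge1$, $1\le j\le n$, such that for $1\le i<j\le n$: $s^{n-1}_{n-2,i}s^n_{n-1,j}=s^{n-1}_{n-2,j-1}s^n_{n-1,i}$; $s^{n-1}_{n-2,i}t^n_{n-1,j}=t^{n-1}_{n-2,j-1}s^n_{n-1,i}$; $t^{n-1}_{n-2,i}s^n_{n-1,j}=s^{n-1}_{n-2,j-1}t^n_{n-1,i}$; $t^{n-1}_{n-2,i}t^n_{n-1,j}=t^{n-1}_{n-2,j-1}t^n_{n-1,i}$. Morphisms are families of maps commuting with all sources and targets. The category is $\mathbb{C}\mathrm{Sets}$. **Reflexive cubical sets.** A reflexive cubical set is a cubical set with maps $1^{n}_{n+1,j}:C_n\to C_{n+1}$ ($n\ge0$, $1\le j\le n+1$; classical reflexions) and $1^{n,\gamma}_{n+1,j}:C_n\to C_{n+1}$ ($n\ge1$, $1\le j\le n$, $\gamma\in\{+,-\}$; connections) such that, whenever the maps are defined (and with $r$ denoting either $s$ everywhere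 or $t$ everywhere): - $1^n_{n+1,i}1^{n-1}_{n,j}=1^n_{n+1,j+1}1^{n-1}_{n,i}$ for $1\le i\le j\le n$; - $r^n_{n-1,i}1^{n-1}_{n,j}=1^{n-2}_{n-1,j-1}r^{n-1}_{n-2,i}$ for $1\le i<j\le n$; $=1^{n-2}_{n-1,j}r^{n-1}_{n-2,i-1}$ for $1\le j<i\le n$; $=\mathrm{id}$ for $i=j$; - $1^{n,\gamma}_{n+1,i}1^{n-1,\gamma}_{n,j}=1^{n,\gamma}_{n+1,j+1}1^{n-1,\gamma}_{n,i}$ for $1\le i<j\le n-1$, and $1^{n,\gamma}_{n+1,i}1^{n-1,\gamma}_{n,i}=1^{n,\gamma}_{n+1,i+1}1^{n-1,\gamma}_{n,i}$ for $1\le i\le n-1$; - $1^{n,\gamma}_{n+1,i}1^{n-1}_{n,j}=1^n_{n+1,j+1}1^{n-1,\gamma}_{n,i}$ for $1\le i<j\le n$; $=1^n_{n+1,j}1^{n-1,\gamma}_{n,i-1}$ for $1\le j<i\le n$; and $1^{n,\gamma}_{n+1,j}1^{n-1}_{n,j}=1^n_{n+1,j}1^{n-1}_{n,j}$ for $1\le j\le n$; - $r^n_{n-1,i}1^{n-1,\gamma}_{n,j}=1^{n-2,\gamma}_{n-1,j-1}r^{n-1}_{n-2,i}$ for $1\le i<j\le n-1$; $=1^{n-2,\gamma}_{n-1,j}r^{n-1}_{n-2,i-1}$ for $2\le j+1<i\le n$; - for $1\le j\le n-1$: $s^n_{n-1,j}1^{n-1,-}_{n,j}=s^n_{n-1,j+1}1^{n-1,-}_{n,j}=\mathrm{id}$,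 $t^n_{n-1,j}1^{n-1,+}_{n,j}=t^n_{n-1,j+1}1^{n-1,+}_{n,j}=\mathrm{id}$, $s^n_{n-1,j}1^{n-1,+}_{n,j}=s^n_{n-1,j+1}1^{n-1,+}_{n,j}=1^{n-2}_{n-1,j}s^{n-1}_{n-2,j}$, $t^n_{n-1,j}1^{n-1,-}_{n,j}=t^n_{n-1,j+1}1^{n-1,-}_{n,j}=1^{n-2}_{n-1,j}t^{n-1}_{n-2,j}$. **Cubical reflexive $\infty$-magmas.** A reflexive cubical set with partial operations $\circ^n_j$ on $C_n$ ($n\ge1$, $1\le j\le n$), where $a\circ^n_jb$ is defined exactly when $t^n_{n-1,j}(a)=s^n_{n-1,j}(b)$, such that $s^n_{n-1,j}(a\circ^n_jb)=s^n_{n-1,j}(a)$, $t^n_{n-1,j}(a\circ^n_jb)=t^n_{n-1,j}(b)$, and for $r\in\{s,t\}$: $r^n_{n-1,i}(a\circ^n_jb)=r^n_{n-1,i}(a)\circ^{n-1}_{j-1}r^n_{n-1,i}(b)$ if $i<j$, and $=r^n_{n-1,i}(a)\circ^{n-1}_{j}r^n_{n-1,i}(b)$ if $j<i$. Morphisms are maps commuting with sources, targets, reflexions, connections and the operations $\circ^n_j$. **Strict cubical $\infty$-categories.** A strict cubical $\infty$-category is a cubical reflexive $\infty$-magma such that the operations are associative and unital ($1^{n-1}_{n,j}(s^n_{n-1,j}(a))\circ^n_ja=a=a\circ^n_j1^{n-1}_{n,j}(t^n_{n-1,j}(a))$), and such that: - interchange: $(a\circ^n_ib)\circ^n_j(c\circ^n_id)=(a\circ^n_jc)\circ^n_i(b\circ^n_jd)$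 for $i\ne j$ whenever both sides are defined; - $1^n_{n+1,i}(a\circ^n_jb)=1^n_{n+1,i}(a)\circ^{n+1}_{j+1}1^n_{n+1,i}(b)$ if $1\le i\le j\le n$, and $=1^n_{n+1,i}(a)\circ^{n+1}_j1^n_{n+1,i}(b)$ if $1\le j<i\le n+1$; - $1^{n,\gamma}_{n+1,i}(a\circ^n_jb)=1^{n,\gamma}_{n+1,i}(a)\circ^{n+1}_{j+1}1^{n,\gamma}_{n+1,i}(b)$ if $1\le i<j\le n$, and $=1^{n,\gamma}_{n+1,i}(a)\circ^{n+1}_j1^{n,\gamma}_{n+1,i}(b)$ if $1\le j<i\le n$; - transport laws, for $1\le j\le n$: $1^{n,+}_{n+1,j}(a\circ^n_jb)=\bigl(1^{n,+}_{n+1,j}(a)\circ^{n+1}_j1^n_{n+1,j}(a)\bigr)\circ^{n+1}_{j+1}\bigl(1^n_{n+1,j+1}(a)\circ^{n+1}_j1^{n,+}_{n+1,j}(b)\bigr)$ and $1^{n,-}_{n+1,j}(a\circ^n_jb)=\bigl(1^{n,-}_{n+1,j}(a)\circ^{n+1}_j1^n_{n+1,j+1}(b)\bigr)\circ^{n+1}_{j+1}\bigl(1^n_{n+1,j}(b)\circ^{n+1}_j1^{n,-}_{n+1,j}(b)\bigr)$; - for $1\le i\le n$: $1^{n,+}_{n+1,i}(x)\circ^{n+1}_i1^{n,-}_{n+1,i}(x)=1^n_{n+1,i+1}(x)$ and $1^{n,+}_{n+1,i}(x)\circ^{n+1}_{i+1}1^{n,-}_{n+1,i}(x)=1^n_{n+1,i}(x)$.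 $\infty\text{-}\mathbb{C}\mathbb{C}\mathrm{AT}$ is the full subcategory of the category of cubical reflexive $\infty$-magmas spanned by strict cubical $\infty$-categories; its morphisms are called strict cubical $\infty$-functors. *)

(* Defs.v *)
(* The logical axioms (through boolp) are used only to equate morphisms with
   the same underlying functions, and proofs of the same proposition. *)
From mathcomp Require Import all_boot.
From mathcomp Require Import boolp.

Set Implicit Arguments.
Unset Strict Implicit.
Unset Printing Implicit Defensive.

Record category := Category {
  ob :> Type;
  hom : ob -> ob -> Type;
  idm : forall a, hom a a;
  compm : forall a b c, hom b c -> hom a b -> hom a c;
  compm1 : forall a b (f : hom a b), compm f (idm a) = f;
  comp1m : forall a b (f : hom a b), compm (idm b) f = f;
  compmA : forall a b c d (h : hom c d) (g : hom b c) (f : hom a b),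
    compm h (compm g f) = compm (compm h g) f }.

Arguments hom {_} _ _.
Arguments idm {_} _.
Arguments compm {_ _ _ _} _ _.

Notation "g ∘ f" := (compm g f) (at level 40, left associativity).

Definition is_iso (C : category) (a b : C) (f : hom a b) : Prop :=
  exists g : hom b a, g ∘ f = idm a /\ f ∘ g = idm b.

Section FullSubcategory.
Variables (C : category) (P : C -> Prop).

Definition full_subcategory : category :=
  @Category {a : C | P a} (fun a b => hom (sval a) (sval b))
    (fun a => idm (sval a)) (fun a b c g f => g ∘ f)
    (fun a b f => compm1 f) (fun a b f => comp1m f)
    (fun a b c d h g f => compmA h g f).

End FullSubcategory.

Record functor (C D : category) := Functor {
  fob :> C -> D;
  fmap : forall a b, hom a b -> hom (fob a) (fob b);
  fmap1 : forall a, fmap (idm a) = idm (fob a);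
  fmapM : forall a b c (g : hom b c) (f : hom a b),
    fmap (g ∘ f) = fmap g ∘ fmap f }.

Arguments fmap {C D} _ {a b} _.

Definition id_functor (C : category) : functor C C :=
  @Functor C C (fun a => a) (fun a b f => f)
    (fun a => erefl) (fun a b c g f => erefl).

Section CompFunctor.
Variables (C D E : category) (G : functor D E) (F : functor C D).

Lemma comp_functor1 (a : C) : fmap G (fmap F (idm a)) = idm (G (F a)).
Proof. by rewrite !fmap1. Qed.

Lemma comp_functorM (a b c : C) (g : hom b c) (f : hom a b) :
  fmap G (fmap F (g ∘ f)) = fmap G (fmap F g) ∘ fmap G (fmap F f).
Proof. by rewrite !fmapM. Qed.

Definition comp_functor : functor C E :=
  @Functor C E (fun a => G (F a)) (fun a b f => fmap G (fmap F f))
    comp_functor1 comp_functorM.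

End CompFunctor.

Record nattrans (C D : category) (F G : functor C D) := Nattrans {
  component :> forall a, hom (F a) (G a);
  naturality : forall a b (f : hom a b),
    component b ∘ fmap F f = fmap G f ∘ component a }.

Definition naturally_isomorphic (C D : category) (F G : functor C D) : Prop :=
  exists t : nattrans F G, forall a, is_iso (t a).

Definition is_equivalence (C D : category) (K : functor C D) : Prop :=
  exists G : functor D C,
    naturally_isomorphic (id_functor C) (comp_functor G K) /\
    naturally_isomorphic (comp_functor K G) (id_functor D).

(* [adjunction F U]: F is left adjoint to U. *)
Record adjunction (C D : category) (F : functor C D) (U : functor D C) :=
  Adjunction {
    adj_unit : nattrans (id_functor C) (comp_functor U F);
    adj_counit : nattrans (comp_functor F U) (id_functor D);
    adj_triangleL : forall c : C,
      adj_counit (F c) ∘ fmap F (adj_unit c) = idm (F c);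
    adj_triangleR : forall d : D,
      fmap U (adj_counit d) ∘ adj_unit (U d) = idm (U d) }.

Definition is_right_adjoint (C D : category) (U : functor D C) : Prop :=
  exists F : functor C D, inhabited (adjunction F U).

Record monad (C : category) := Monad {
  mfun :> functor C C;
  munit : nattrans (id_functor C) mfun;
  mmult : nattrans (comp_functor mfun mfun) mfun;
  munitL : forall c, mmult c ∘ munit (mfun c) = idm (mfun c);
  munitR : forall c, mmult c ∘ fmap mfun (munit c) = idm (mfun c);
  mmultA : forall c,
    mmult c ∘ fmap mfun (mmult c) = mmult c ∘ mmult (mfun c) }.

Section EilenbergMoore.
Variables (C : category) (T : monad C).

Record algebra := Algebra {
  alg_car : C;
  alg_act : hom (T alg_car) alg_car;
  alg_unit : alg_act ∘ munit T alg_car = idm alg_car;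
  alg_assoc : alg_act ∘ fmap T alg_act = alg_act ∘ mmult T alg_car }.

Record alg_hom (A B : algebra) := AlgHom {
  alg_map : hom (alg_car A) (alg_car B);
  alg_mapP : alg_map ∘ alg_act A = alg_act B ∘ fmap T alg_map }.

Lemma alg_hom_eq (A B : algebra) (f g : alg_hom A B) :
  alg_map f = alg_map g -> f = g.
Proof.
by case: f g => [f fP] [g gP] /= e; subst g; congr AlgHom; exact: Prop_irrelevance.
Qed.

Lemma alg_idP (A : algebra) :
  idm (alg_car A) ∘ alg_act A = alg_act A ∘ fmap T (idm (alg_car A)).
Proof. by rewrite fmap1 comp1m compm1. Qed.

Lemma alg_compP (A B D : algebra) (g : alg_hom B D) (f : alg_hom A B) :
  (alg_map g ∘ alg_map f) ∘ alg_act A =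
  alg_act D ∘ fmap T (alg_map g ∘ alg_map f).
Proof. by rewrite fmapM compmA -alg_mapP -!compmA alg_mapP. Qed.

Definition alg_id A : alg_hom A A := AlgHom (alg_idP A).

Definition alg_comp A B D (g : alg_hom B D) (f : alg_hom A B) : alg_hom A D :=
  AlgHom (alg_compP g f).

Lemma alg_comp1 A B (f : alg_hom A B) : alg_comp f (alg_id A) = f.
Proof. by apply: alg_hom_eq; rewrite /= compm1. Qed.

Lemma alg_1comp A B (f : alg_hom A B) : alg_comp (alg_id B) f = f.
Proof. by apply: alg_hom_eq; rewrite /= comp1m. Qed.

Lemma alg_compA A B D E (h : alg_hom D E) (g : alg_hom B D) (f : alg_hom A B) :
  alg_comp h (alg_comp g f) = alg_comp (alg_comp h g) f.
Proof. by apply: alg_hom_eq; rewrite /= compmA. Qed.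

Definition EM_category : category :=
  @Category algebra alg_hom alg_id alg_comp alg_comp1 alg_1comp alg_compA.

End EilenbergMoore.

Section Comparison.
Variables (C D : category) (F : functor C D) (U : functor D C).
Variable adj : adjunction F U.

Let eta := adj_unit adj.
Let eps := adj_counit adj.

Lemma adj_mult_nat (a b : C) (f : hom a b) :
  fmap U (eps (F b)) ∘ fmap U (fmap F (fmap U (fmap F f))) =
  fmap U (fmap F f) ∘ fmap U (eps (F a)).
Proof. by rewrite -!fmapM; congr fmap; exact: (naturality eps (fmap F f)). Qed.

Definition adj_mult : nattrans
    (comp_functor (comp_functor U F) (comp_functor U F)) (comp_functor U F) :=
  @Nattrans C C (comp_functor (comp_functor U F) (comp_functor U F))
    (comp_functor U F) (fun c => fmap U (eps (F c))) adj_mult_nat.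

Lemma adj_munitR (c : C) :
  fmap U (eps (F c)) ∘ fmap U (fmap F (eta c)) = idm (U (F c)).
Proof. by rewrite -fmapM adj_triangleL fmap1. Qed.

Lemma adj_act_assoc (d : D) :
  fmap U (eps d) ∘ fmap U (fmap F (fmap U (eps d))) =
  fmap U (eps d) ∘ fmap U (eps (F (U d))).
Proof. by rewrite -!fmapM; congr fmap; exact: (naturality eps (eps d)). Qed.

Definition adj_monad : monad C :=
  @Monad C (comp_functor U F) eta adj_mult
    (fun c => adj_triangleR adj (F c)) adj_munitR (fun c => adj_act_assoc (F c)).

Definition comparison_ob (d : D) : algebra adj_monad :=
  @Algebra C adj_monad (U d) (fmap U (eps d))
    (adj_triangleR adj d) (adj_act_assoc d).

Lemma comparison_mapP (d d' : D) (f : hom d d') :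
  fmap U f ∘ fmap U (eps d) = fmap U (eps d') ∘ fmap U (fmap F (fmap U f)).
Proof. by rewrite -!fmapM; congr fmap; symmetry; exact: (naturality eps f). Qed.

Definition comparison_map (d d' : D) (f : hom d d') :
    alg_hom (comparison_ob d) (comparison_ob d') :=
  @AlgHom C adj_monad (comparison_ob d) (comparison_ob d') (fmap U f)
    (comparison_mapP f).

Lemma comparison_map1 (d : D) :
  comparison_map (idm d) = alg_id (comparison_ob d).
Proof. by apply: alg_hom_eq; exact: fmap1. Qed.

Lemma comparison_mapM (a b c : D) (g : hom b c) (f : hom a b) :
  comparison_map (g ∘ f) = alg_comp (comparison_map g) (comparison_map f).
Proof. by apply: alg_hom_eq; exact: fmapM. Qed.

Definition comparison_functor : functor D (EM_category adj_monad) :=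
  @Functor D (EM_category adj_monad) comparison_ob comparison_map
    comparison_map1 comparison_mapM.

End Comparison.

Definition is_monadic (C D : category) (U : functor D C) : Prop :=
  exists (F : functor C D) (adj : adjunction F U),
    is_equivalence (comparison_functor adj).

(* Directions are 0-based: the direction 1 <= j <= n of an n-cell is the
   ordinal j - 1 : 'I_n.  In each axiom the ordinals that index the maps are
   quantified separately and related through their values; the types of these
   ordinals impose exactly the ranges in which the maps are defined. *)

Inductive side := Src | Tgt.

Inductive sign := Neg | Pos.

Record cubicalSet := CubicalSet {
  cell :> nat -> Type;
  face : side -> forall n, 'I_n.+1 -> cell n.+1 -> cell n;
  face_face : forall (a b : side) n (i j : 'I_n.+2) (i' j' : 'I_n.+1)
      (x : cell n.+2),
    i < j -> i' = i :> nat -> j = j'.+1 :> nat ->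
    face a i' (face b j x) = face b j' (face a i x) }.

Arguments face {_} _ {n} _ _.

Notation src := (face Src).
Notation tgt := (face Tgt).

Record cubicalHom (A B : cubicalSet) := CubicalHom {
  chom :> forall n, A n -> B n;
  chom_face : forall (r : side) n (i : 'I_n.+1) (x : A n.+1),
    chom (face r i x) = face r i (chom x) }.

Arguments chom {A B} _ n _.

(* There are no connections on 0-cells, since 'I_0 is empty. *)
Record reflCubicalSet := ReflCubicalSet {
  rcs_cset :> cubicalSet;
  refl : forall n, 'I_n.+1 -> rcs_cset n -> rcs_cset n.+1;
  conn : sign -> forall n, 'I_n -> rcs_cset n -> rcs_cset n.+1;
  refl_refl : forall n (i j : 'I_n.+1) (i' j' : 'I_n.+2) (x : rcs_cset n),
    i <= j -> i' = i :> nat -> j' = j.+1 :> nat ->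
    refl i' (refl j x) = refl j' (refl i x);
  face_refl_lt : forall (r : side) n (i j : 'I_n.+2) (i' j' : 'I_n.+1)
      (x : rcs_cset n.+1),
    i < j -> i' = i :> nat -> j = j'.+1 :> nat ->
    face r i (refl j x) = refl j' (face r i' x);
  face_refl_gt : forall (r : side) n (i j : 'I_n.+2) (i' j' : 'I_n.+1)
      (x : rcs_cset n.+1),
    j < i -> i = i'.+1 :> nat -> j' = j :> nat ->
    face r i (refl j x) = refl j' (face r i' x);
  face_refl_eq : forall (r : side) n (j : 'I_n.+1) (x : rcs_cset n),
    face r j (refl j x) = x;
  conn_conn_lt : forall (g : sign) n (i j : 'I_n) (i' j' : 'I_n.+1)
      (x : rcs_cset n),
    i < j -> i' = i :> nat -> j' = j.+1 :> nat ->
    conn g i' (conn g j x) = conn g j' (conn g i x);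
  conn_conn_eq : forall (g : sign) n (i : 'I_n) (i0 i1 : 'I_n.+1)
      (x : rcs_cset n),
    i0 = i :> nat -> i1 = i.+1 :> nat ->
    conn g i0 (conn g i x) = conn g i1 (conn g i x);
  conn_refl_lt : forall (g : sign) n (i : 'I_n) (j i' : 'I_n.+1) (j' : 'I_n.+2)
      (x : rcs_cset n),
    i < j -> i' = i :> nat -> j' = j.+1 :> nat ->
    conn g i' (refl j x) = refl j' (conn g i x);
  conn_refl_gt : forall (g : sign) n (i j : 'I_n.+1) (i' : 'I_n) (j' : 'I_n.+2)
      (x : rcs_cset n),
    j < i -> i = i'.+1 :> nat -> j' = j :> nat ->
    conn g i (refl j x) = refl j' (conn g i' x);
  conn_refl_eq : forall (g : sign) n (j : 'I_n.+1) (j' : 'I_n.+2)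
      (x : rcs_cset n),
    j' = j :> nat ->
    conn g j (refl j x) = refl j' (refl j x);
  face_conn_lt : forall (r : side) (g : sign) n (i : 'I_n.+2) (j i' : 'I_n.+1)
      (j' : 'I_n) (x : rcs_cset n.+1),
    i < j -> i' = i :> nat -> j = j'.+1 :> nat ->
    face r i (conn g j x) = conn g j' (face r i' x);
  face_conn_gt : forall (r : side) (g : sign) n (i : 'I_n.+2) (j i' : 'I_n.+1)
      (j' : 'I_n) (x : rcs_cset n.+1),
    j.+1 < i -> i = i'.+1 :> nat -> j' = j :> nat ->
    face r i (conn g j x) = conn g j' (face r i' x);
  src_conn_neg : forall n (j : 'I_n.+1) (k : 'I_n.+2) (x : rcs_cset n.+1),
    k = j :> nat \/ k = j.+1 :> nat ->
    src k (conn Neg j x) = x;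
  tgt_conn_pos : forall n (j : 'I_n.+1) (k : 'I_n.+2) (x : rcs_cset n.+1),
    k = j :> nat \/ k = j.+1 :> nat ->
    tgt k (conn Pos j x) = x;
  src_conn_pos : forall n (j : 'I_n.+1) (k : 'I_n.+2) (x : rcs_cset n.+1),
    k = j :> nat \/ k = j.+1 :> nat ->
    src k (conn Pos j x) = refl j (src j x);
  tgt_conn_neg : forall n (j : 'I_n.+1) (k : 'I_n.+2) (x : rcs_cset n.+1),
    k = j :> nat \/ k = j.+1 :> nat ->
    tgt k (conn Neg j x) = refl j (tgt j x) }.

Arguments refl {_ n} _ _.
Arguments conn {_} _ {n} _ _.

(* The partial composition [pcomp j a b h] takes a proof [h] that a and b are
   composable.  Axioms are quantified over all composability proofs they
   mention, i.e. they hold whenever the compositions are defined. *)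

Record cubicalMagma := CubicalMagma {
  mag_rcs :> reflCubicalSet;
  pcomp : forall n (j : 'I_n.+1) (a b : mag_rcs n.+1),
    tgt j a = src j b -> mag_rcs n.+1;
  src_pcomp : forall n (j : 'I_n.+1) (a b : mag_rcs n.+1)
      (h : tgt j a = src j b),
    src j (@pcomp _ j a b h) = src j a;
  tgt_pcomp : forall n (j : 'I_n.+1) (a b : mag_rcs n.+1)
      (h : tgt j a = src j b),
    tgt j (@pcomp _ j a b h) = tgt j b;
  face_pcomp_lt : forall (r : side) n (i j : 'I_n.+2) (j' : 'I_n.+1)
      (a b : mag_rcs n.+2) (h : tgt j a = src j b)
      (h' : tgt j' (face r i a) = src j' (face r i b)),
    i < j -> j = j'.+1 :> nat ->
    face r i (@pcomp _ j a b h) = @pcomp _ j' (face r i a) (face r i b) h';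
  face_pcomp_gt : forall (r : side) n (i j : 'I_n.+2) (j' : 'I_n.+1)
      (a b : mag_rcs n.+2) (h : tgt j a = src j b)
      (h' : tgt j' (face r i a) = src j' (face r i b)),
    j < i -> j' = j :> nat ->
    face r i (@pcomp _ j a b h) = @pcomp _ j' (face r i a) (face r i b) h' }.

Arguments pcomp {_ n} j a b h.

Record magmaHom (A B : cubicalMagma) := MagmaHom {
  mag_chom :> cubicalHom A B;
  mhom_refl : forall n (i : 'I_n.+1) (x : A n),
    mag_chom _ (refl i x) = refl i (mag_chom _ x);
  mhom_conn : forall (g : sign) n (i : 'I_n) (x : A n),
    mag_chom _ (conn g i x) = conn g i (mag_chom _ x);
  mhom_pcomp : forall n (j : 'I_n.+1) (a b : A n.+1) (h : tgt j a = src j b)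
      (h' : tgt j (mag_chom _ a) = src j (mag_chom _ b)),
    mag_chom _ (pcomp j a b h) = pcomp j (mag_chom _ a) (mag_chom _ b) h' }.

Record is_strict (M : cubicalMagma) : Prop := IsStrict {
  pcompA : forall n (j : 'I_n.+1) (a b c : M n.+1) hab habc hbc habc',
    pcomp j (pcomp j a b hab) c habc = pcomp j a (pcomp j b c hbc) habc';
  pcomp_unitl : forall n (j : 'I_n.+1) (a : M n.+1) h,
    pcomp j (refl j (src j a)) a h = a;
  pcomp_unitr : forall n (j : 'I_n.+1) (a : M n.+1) h,
    pcomp j a (refl j (tgt j a)) h = a;
  interchange : forall n (i j : 'I_n.+1) (a b c d : M n.+1)
      hab hcd hj hac hbd hi,
    i <> j ->
    pcomp j (pcomp i a b hab) (pcomp i c d hcd) hj =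
    pcomp i (pcomp j a c hac) (pcomp j b d hbd) hi;
  refl_pcomp_le : forall n (i j' : 'I_n.+2) (j : 'I_n.+1) (a b : M n.+1) h h',
    i <= j -> j' = j.+1 :> nat ->
    refl i (pcomp j a b h) = pcomp j' (refl i a) (refl i b) h';
  refl_pcomp_gt : forall n (i j' : 'I_n.+2) (j : 'I_n.+1) (a b : M n.+1) h h',
    j < i -> j' = j :> nat ->
    refl i (pcomp j a b h) = pcomp j' (refl i a) (refl i b) h';
  conn_pcomp_lt : forall (g : sign) n (i j : 'I_n.+1) (j' : 'I_n.+2)
      (a b : M n.+1) h h',
    i < j -> j' = j.+1 :> nat ->
    conn g i (pcomp j a b h) = pcomp j' (conn g i a) (conn g i b) h';
  conn_pcomp_gt : forall (g : sign) n (i j : 'I_n.+1) (j' : 'I_n.+2)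
      (a b : M n.+1) h h',
    j < i -> j' = j :> nat ->
    conn g i (pcomp j a b h) = pcomp j' (conn g i a) (conn g i b) h';
  transport_pos : forall n (j : 'I_n.+1) (j0 j1 : 'I_n.+2) (a b : M n.+1)
      h h1 h2 h3,
    j0 = j :> nat -> j1 = j.+1 :> nat ->
    conn Pos j (pcomp j a b h) =
    pcomp j1 (pcomp j0 (conn Pos j a) (refl j0 a) h1)
             (pcomp j0 (refl j1 a) (conn Pos j b) h2) h3;
  transport_neg : forall n (j : 'I_n.+1) (j0 j1 : 'I_n.+2) (a b : M n.+1)
      h h1 h2 h3,
    j0 = j :> nat -> j1 = j.+1 :> nat ->
    conn Neg j (pcomp j a b h) =
    pcomp j1 (pcomp j0 (conn Neg j a) (refl j1 b) h1)
             (pcomp j0 (refl j0 b) (conn Neg j b) h2) h3;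
  conn_pcomp0 : forall n (i : 'I_n.+1) (i0 i1 : 'I_n.+2) (x : M n.+1) h,
    i0 = i :> nat -> i1 = i.+1 :> nat ->
    pcomp i0 (conn Pos i x) (conn Neg i x) h = refl i1 x;
  conn_pcomp1 : forall n (i : 'I_n.+1) (i0 i1 : 'I_n.+2) (x : M n.+1) h,
    i0 = i :> nat -> i1 = i.+1 :> nat ->
    pcomp i1 (conn Pos i x) (conn Neg i x) h = refl i0 x }.

Lemma cubicalHom_eq (A B : cubicalSet) (f g : cubicalHom A B) :
  (forall n (x : A n), f n x = g n x) -> f = g.
Proof.
case: f g => [f fP] [g gP] /= e.
have {}e : f = g by apply/functional_extensionality_dep => n; exact/funext/e.
by subst g; congr CubicalHom; exact: Prop_irrelevance.
Qed.

Lemma cubical_id_face (A : cubicalSet) (r : side) n (i : 'I_n.+1) (x : A n.+1) :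
  face r i x = face r i x.
Proof. by []. Qed.

Definition cubical_id (A : cubicalSet) : cubicalHom A A :=
  @CubicalHom A A (fun n x => x) (@cubical_id_face A).

Lemma cubical_comp_face (A B C : cubicalSet) (g : cubicalHom B C)
    (f : cubicalHom A B) (r : side) n (i : 'I_n.+1) (x : A n.+1) :
  g n (f n (face r i x)) = face r i (g n.+1 (f n.+1 x)).
Proof. by rewrite !chom_face. Qed.

Definition cubical_comp (A B C : cubicalSet) (g : cubicalHom B C)
    (f : cubicalHom A B) : cubicalHom A C :=
  @CubicalHom A C (fun n x => g n (f n x)) (cubical_comp_face g f).

Definition CSets : category.
Proof.
refine (@Category cubicalSet cubicalHom cubical_id cubical_comp _ _ _).
- by move=> A B f; apply: cubicalHom_eq.
- by move=> A B f; apply: cubicalHom_eq.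
- by move=> A B C D h g f; apply: cubicalHom_eq.
Defined.

Lemma magmaHom_eq (A B : cubicalMagma) (f g : magmaHom A B) :
  (forall n (x : A n), f n x = g n x) -> f = g.
Proof.
case: f g => [f fr fc fp] [g gr gc gp] /= e.
have {}e : f = g by exact: cubicalHom_eq.
by subst g; congr MagmaHom; exact: Prop_irrelevance.
Qed.

Definition magma_id (A : cubicalMagma) : magmaHom A A.
Proof.
refine (@MagmaHom A A (cubical_id A) _ _ _) => //= n j a b h h'.
by rewrite (Prop_irrelevance h h').
Defined.

Definition magma_comp (A B C : cubicalMagma) (g : magmaHom B C)
  (f : magmaHom A B) : magmaHom A C.
Proof.
refine (@MagmaHom A C (cubical_comp g f) _ _ _) => /=.
- by move=> n i x; rewrite !mhom_refl.
- by move=> s n i x; rewrite !mhom_conn.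
- move=> n j a b h h'.
  have hf : tgt j (f n.+1 a) = src j (f n.+1 b) by rewrite -!chom_face h.
  by rewrite (@mhom_pcomp _ _ f _ _ _ _ h hf) (@mhom_pcomp _ _ g _ _ _ _ hf h').
Defined.

Definition CMagmas : category.
Proof.
refine (@Category cubicalMagma magmaHom magma_id magma_comp _ _ _).
- by move=> A B f; apply: magmaHom_eq.
- by move=> A B f; apply: magmaHom_eq.
- by move=> A B C D h g f; apply: magmaHom_eq.
Defined.

Definition infCCAT : category := @full_subcategory CMagmas is_strict.

Definition forgetful : functor infCCAT CSets :=
  @Functor infCCAT CSets (fun X => sval X : cubicalSet)
    (fun X Y f => mag_chom f) (fun X => erefl) (fun X Y Z g f => erefl).

(* Main.v *)
From mathcomp Require Import all_boot.
From mathcomp Require Import boolp.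
Require Import Defs.

Set Implicit Arguments.
Unset Strict Implicit.
Unset Printing Implicit Defensive.

(** Strict cubical categories are the models of an algebraic theory over
    cubical sets: each operation is defined on tuples of cells cut out by
    equations between faces of its arguments, and each axiom is an equation
    whose domain of validity is, once earlier axioms are used, again described
    by faces of the variables alone.  For an essentially algebraic theory in
    general the forgetful functor has a left adjoint but need not be monadic;
    the shape of the domains is what makes it monadic here.

    The one place where the axioms are examined is [separated_strict].  There
    a cubical set [X] with operations is compared with strict categories [M],
    by means of probes: a cubical map [X -> M] used to move the variables of
    an axiom into [M], and a relation between [M] and [X], compatible with all
    operations, used to carry the two sides of the axiom back.  If probes
    distinguish the cells of [X], then [X] is strict.  This covers both
    closure under jointly injective families of morphisms into strict
    categories (the relation is the graph of a morphism [X -> M]) and closure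
    under those quotients [M -> X] which split as maps of cubical sets (the
    relation is the graph of the quotient map).

    The first case constructs free categories.  A cell of the free category on
    [X] is a formal term that has a value in every strict category under [X],
    and two terms are identified when all their values agree.  Evaluations are
    jointly injective by construction, so the free category is strict, and
    they are the morphisms required by the universal property.

    The second case constructs a strict category from an algebra
    [act : T X -> X] of the induced monad.  The operations of [X] apply [act]
    to the operations of the free category on generators.  Associativity of
    the action makes [act] commute with the operations, and its unit law makes
    [gen : X -> T X] a splitting, so [X] is strict and [act] becomes a
    morphism from the free category.  As such a morphism is determined by its
    values on generators, [act] is the counit at [X], and this construction is
    inverse to the comparison functor. *)

(** * Composability *)

Lemma chom_composable (A B : cubicalSet) (f : cubicalHom A B) n (j : 'I_n.+1)
    (a b : A n.+1) :
  tgt j a = src j b -> tgt j (f _ a) = src j (f _ b).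
Proof. by move=> h; rewrite -!chom_face h. Qed.

(** A composite is formed with a proof that its arguments are composable, so
    moving an axiom from one structure to another requires these proofs in the
    target.  The results of this part derive the composability of the composites
    occurring in an axiom from that of its variables. *)
Section Composability.
Variable M : cubicalMagma.

Lemma pcomp_congr n (j : 'I_n.+1) (a a' b b' : M n.+1) h h' :
  a = a' -> b = b' -> pcomp j a b h = pcomp j a' b' h'.
Proof. by move=> ea eb; subst; rewrite (Prop_irrelevance h h'). Qed.

Lemma refl_composable_le n (i j' : 'I_n.+2) (j : 'I_n.+1) (a b : M n.+1) :
  i <= j -> j' = j.+1 :> nat -> tgt j a = src j b ->
  tgt j' (refl i a) = src j' (refl i b).
Proof.
move=> lij ej h; have li : i < n.+1 by apply: leq_ltn_trans lij _.
have lt : i < j' by rewrite ej.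
by rewrite !(@face_refl_gt M _ n j' i j (Ordinal li)) ?h.
Qed.

Lemma refl_composable_gt n (i j' : 'I_n.+2) (j : 'I_n.+1) (a b : M n.+1) :
  j < i -> j' = j :> nat -> tgt j a = src j b ->
  tgt j' (refl i a) = src j' (refl i b).
Proof.
move=> lji ej h; case: i lji => -[//|i] li /= lji.
by rewrite !(@face_refl_lt M _ n j' (Ordinal li) j (Ordinal (li : i < n.+1))) ?h
  //= ej.
Qed.

Lemma conn_composable_lt g n (i j : 'I_n.+1) (j' : 'I_n.+2) (a b : M n.+1) :
  i < j -> j' = j.+1 :> nat -> tgt j a = src j b ->
  tgt j' (conn g i a) = src j' (conn g i b).
Proof.
move=> lij ej h.
have li : i < n by apply: leq_trans lij _; rewrite -ltnS.
by rewrite !(@face_conn_gt M _ g n j' i j (Ordinal li)) ?h //= ej ltnS.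
Qed.

Lemma conn_composable_gt g n (i j : 'I_n.+1) (j' : 'I_n.+2) (a b : M n.+1) :
  j < i -> j' = j :> nat -> tgt j a = src j b ->
  tgt j' (conn g i a) = src j' (conn g i b).
Proof.
move=> lji ej h; case: i lji => -[//|i] li /= lji.
by rewrite !(@face_conn_lt M _ g n j' (Ordinal li) j (Ordinal (li : i < n))) ?h
  //= ej.
Qed.

(** Faces in direction [j] distribute over composition in direction [i], so
    composability in direction [j] passes to composites in direction [i]. *)
Lemma pcomp_composable n (i j : 'I_n.+1) (a b c d : M n.+1)
    (hab : tgt i a = src i b) (hcd : tgt i c = src i d) :
  i <> j -> tgt j a = src j c -> tgt j b = src j d ->
  tgt j (pcomp i a b hab) = src j (pcomp i c d hcd).
Proof.
case: n i j a b c d hab hcd => [|n] i j a b c d hab hcd ne hac hbd.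
  (* Cells of dimension one have a single direction. *)
  by case: ne; rewrite !ord1.
have := negbT (introF eqP ne); rewrite -val_eqE neq_ltn /= => /orP[lij | lji].
- have li : i < n.+1 by apply: leq_trans lij _; rewrite -ltnS.
  have fd r (x y : M n.+2) : tgt i x = src i y ->
      tgt (Ordinal li) (face r j x) = src (Ordinal li) (face r j y).
    case: j lij {hac hbd ne} => -[//|j] lj lij h.
    by rewrite !(@face_face M _ _ n i (Ordinal lj) (Ordinal li)
      (Ordinal (lj : j < n.+1))) ?h.
  rewrite (@face_pcomp_gt M Tgt n j i (Ordinal li) _ _ _ (fd _ _ _ hab)) //.
  rewrite (@face_pcomp_gt M Src n j i (Ordinal li) _ _ _ (fd _ _ _ hcd)) //.
  exact: pcomp_congr.
- case: i lji {ne} hab hcd => -[//|i] li lji hab hcd.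
  have lj : j < n.+1 by apply: leq_trans lji _.
  have fd r (x y : M n.+2) : tgt (Ordinal li) x = src (Ordinal li) y ->
      tgt (Ordinal (li : i < n.+1)) (face r j x) =
      src (Ordinal (li : i < n.+1)) (face r j y).
    move=> h.
    by rewrite -!(@face_face M _ _ n j (Ordinal li) (Ordinal lj)
      (Ordinal (li : i < n.+1))) ?h.
  rewrite (@face_pcomp_lt M Tgt n j _ (Ordinal (li : i < n.+1)) _ _ _
    (fd _ _ _ hab)) //.
  rewrite (@face_pcomp_lt M Src n j _ (Ordinal (li : i < n.+1)) _ _ _
    (fd _ _ _ hcd)) //.
  exact: pcomp_congr.
Qed.

Section Transport.
Variables (n : nat) (j : 'I_n.+1) (j0 j1 : 'I_n.+2) (a b : M n.+1).
Hypotheses (e0 : j0 = j :> nat) (e1 : j1 = j.+1 :> nat).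
Hypothesis h : tgt j a = src j b.

Let lt01 : j0 < j1. Proof. by rewrite e0 e1. Qed.
Let c0 : j0 = j :> nat \/ j0 = j.+1 :> nat. Proof. by left. Qed.
Let c1 : j1 = j :> nat \/ j1 = j.+1 :> nat. Proof. by right. Qed.

Lemma face_refl_next r (x : M n.+1) :
  face r j0 (refl j1 x) = refl j (face r j x).
Proof. by rewrite (@face_refl_lt M r n j0 j1 j j). Qed.

Lemma face_refl_prev r (x : M n.+1) :
  face r j1 (refl j0 x) = refl j (face r j x).
Proof. by rewrite (@face_refl_gt M r n j1 j0 j j). Qed.

Lemma conn_pos_refl_composable : tgt j0 (conn Pos j a) = src j0 (refl j0 a).
Proof. by rewrite tgt_conn_pos // face_refl_eq. Qed.

Lemma refl_conn_pos_composable : tgt j0 (refl j1 a) = src j0 (conn Pos j b).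
Proof. by rewrite face_refl_next src_conn_pos // h. Qed.

Lemma conn_neg_refl_composable : tgt j0 (conn Neg j a) = src j0 (refl j1 b).
Proof. by rewrite face_refl_next tgt_conn_neg // h. Qed.

Lemma refl_conn_neg_composable : tgt j0 (refl j0 b) = src j0 (conn Neg j b).
Proof. by rewrite src_conn_neg // face_refl_eq. Qed.

Lemma conn_pos_neg_composable0 (x : M n.+1) :
  tgt j0 (conn Pos j x) = src j0 (conn Neg j x).
Proof. by rewrite tgt_conn_pos // src_conn_neg. Qed.

Lemma conn_pos_neg_composable1 (x : M n.+1) :
  tgt j1 (conn Pos j x) = src j1 (conn Neg j x).
Proof. by rewrite tgt_conn_pos // src_conn_neg. Qed.

Lemma unitl_composable (x : M n.+1) : tgt j (refl j (src j x)) = src j x.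
Proof. by rewrite face_refl_eq. Qed.

Lemma unitr_composable (x : M n.+1) : tgt j x = src j (refl j (tgt j x)).
Proof. by rewrite face_refl_eq. Qed.

Hypothesis strictM : is_strict M.

(** The two rows of the transport square meet along [a]: each of the two faces
    is the composite of [a] with a degenerate cell. *)
Lemma transport_pos_composable h1 h2 :
  tgt j1 (pcomp j0 (conn Pos j a) (refl j0 a) h1) =
  src j1 (pcomp j0 (refl j1 a) (conn Pos j b) h2).
Proof.
have ha : tgt j (tgt j1 (conn Pos j a)) = src j (tgt j1 (refl j0 a)).
  by rewrite tgt_conn_pos // face_refl_prev -unitr_composable.
have hb : tgt j (src j1 (refl j1 a)) = src j (src j1 (conn Pos j b)).
  by rewrite src_conn_pos // face_refl_eq face_refl_eq.
rewrite (@face_pcomp_gt M Tgt n j1 j0 j _ _ h1 ha) //.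
rewrite (@face_pcomp_gt M Src n j1 j0 j _ _ h2 hb) //.
transitivity a.
  rewrite -[RHS](pcomp_unitr strictM (unitr_composable a)).
  by apply: pcomp_congr; [rewrite tgt_conn_pos | rewrite face_refl_prev].
rewrite -[LHS](pcomp_unitr strictM (unitr_composable a)).
by apply: pcomp_congr; [rewrite face_refl_eq | rewrite src_conn_pos // h].
Qed.

(** The two rows of the transport square meet along [b]: each of the two faces
    is the composite of a degenerate cell with [b]. *)
Lemma transport_neg_composable h1 h2 :
  tgt j1 (pcomp j0 (conn Neg j a) (refl j1 b) h1) =
  src j1 (pcomp j0 (refl j0 b) (conn Neg j b) h2).
Proof.
have ha : tgt j (tgt j1 (conn Neg j a)) = src j (tgt j1 (refl j1 b)).
  by rewrite tgt_conn_neg // !face_refl_eq.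
have hb : tgt j (src j1 (refl j0 b)) = src j (src j1 (conn Neg j b)).
  by rewrite src_conn_neg // face_refl_prev face_refl_eq.
rewrite (@face_pcomp_gt M Tgt n j1 j0 j _ _ h1 ha) //.
rewrite (@face_pcomp_gt M Src n j1 j0 j _ _ h2 hb) //.
transitivity b.
  rewrite -[RHS](pcomp_unitl strictM (unitl_composable b)).
  by apply: pcomp_congr; [rewrite tgt_conn_neg // h | rewrite face_refl_eq].
rewrite -[LHS](pcomp_unitl strictM (unitl_composable b)).
by apply: pcomp_congr; [rewrite face_refl_prev | rewrite src_conn_neg].
Qed.

End Transport.
End Composability.

(** * Structures separated by strict categories *)

Record cubicalOps (X : cubicalSet) := CubicalOps {
  op_refl : forall n, 'I_n.+1 -> X n -> X n.+1;
  op_conn : sign -> forall n, 'I_n -> X n -> X n.+1;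
  op_pcomp : forall n (j : 'I_n.+1) (a b : X n.+1),
    tgt j a = src j b -> X n.+1 }.

(** The map [lift] and the relation [represents] are independent data because
    the two uses of probes start from opposite directions: either a morphism
    [X -> probe_cat] is given, and [represents] is its graph, or a morphism
    [probe_cat -> X] is given with a section [lift], and [represents] is the
    graph of that morphism. *)
Record probe (X : cubicalSet) (O : cubicalOps X) := Probe {
  probe_cat : cubicalMagma;
  probe_strict : is_strict probe_cat;
  lift : cubicalHom X probe_cat;
  represents : forall n, probe_cat n -> X n -> Prop;
  represents_lift : forall n (x : X n), represents (lift n x) x;
  represents_face : forall r n (i : 'I_n.+1) m (x : X n.+1),
    represents m x -> represents (face r i m) (face r i x);
  represents_refl : forall n (i : 'I_n.+1) m (x : X n),
    represents m x -> represents (refl i m) (op_refl O i x);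
  represents_conn : forall g n (i : 'I_n) m (x : X n),
    represents m x -> represents (conn g i m) (op_conn O g i x);
  represents_pcomp : forall n (j : 'I_n.+1) u v (a b : X n.+1) h h',
    represents u a -> represents v b ->
    represents (pcomp j u v h) (@op_pcomp X O n j a b h') }.

Arguments lift {X O} p.
Arguments represents {X O} p {n} m x.

Definition separated (X : cubicalSet) (O : cubicalOps X) : Prop :=
  forall n (x y : X n),
    (forall p : probe O, exists2 m, represents p m x & represents p m y) ->
    x = y.

Ltac transfer := repeat
  (apply: represents_lift || apply: represents_face || apply: represents_refl
   || apply: represents_conn || apply: represents_pcomp).

Section Separated.
Variables (X : cubicalSet) (O : cubicalOps X).
Hypothesis sepO : separated O.

Lemma lift_face_composable (p : probe O) r n (i : 'I_n.+2) (j : 'I_n.+1)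
    (a b : X n.+2) :
  tgt j (face r i a) = src j (face r i b) ->
  tgt j (face r i (lift p n.+2 a)) = src j (face r i (lift p n.+2 b)).
Proof. by move=> h; rewrite -!chom_face h. Qed.

(** Every axiom is checked in the same way.  In each probe the lifts of the
    variables satisfy the axiom; the common value of its two sides represents
    both sides of the axiom in [X], so separation identifies them. *)
Definition separated_rcs : reflCubicalSet.
Proof.
refine (@ReflCubicalSet X (op_refl O) (op_conn O)
  _ _ _ _ _ _ _ _ _ _ _ _ _ _ _).
- move=> n i j i' j' x l e e'; apply: sepO => p.
  exists (refl i' (refl j (lift p _ x))); first by transfer.
  by rewrite (refl_refl _ l e e'); transfer.
- move=> r n i j i' j' x l e e'; apply: sepO => p.
  exists (face r i (refl j (lift p _ x))); first by transfer.
  by rewrite (face_refl_lt _ _ l e e'); transfer.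
- move=> r n i j i' j' x l e e'; apply: sepO => p.
  exists (face r i (refl j (lift p _ x))); first by transfer.
  by rewrite (face_refl_gt _ _ l e e'); transfer.
- move=> r n j x; apply: sepO => p.
  exists (face r j (refl j (lift p _ x))); first by transfer.
  by rewrite face_refl_eq; transfer.
- move=> g n i j i' j' x l e e'; apply: sepO => p.
  exists (conn g i' (conn g j (lift p _ x))); first by transfer.
  by rewrite (conn_conn_lt _ _ l e e'); transfer.
- move=> g n i i0 i1 x e e'; apply: sepO => p.
  exists (conn g i0 (conn g i (lift p _ x))); first by transfer.
  by rewrite (conn_conn_eq _ _ e e'); transfer.
- move=> g n i j i' j' x l e e'; apply: sepO => p.
  exists (conn g i' (refl j (lift p _ x))); first by transfer.
  by rewrite (conn_refl_lt _ _ l e e'); transfer.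
- move=> g n i j i' j' x l e e'; apply: sepO => p.
  exists (conn g i (refl j (lift p _ x))); first by transfer.
  by rewrite (conn_refl_gt _ _ l e e'); transfer.
- move=> g n j j' x e; apply: sepO => p.
  exists (conn g j (refl j (lift p _ x))); first by transfer.
  by rewrite (conn_refl_eq _ _ e); transfer.
- move=> r g n i j i' j' x l e e'; apply: sepO => p.
  exists (face r i (conn g j (lift p _ x))); first by transfer.
  by rewrite (face_conn_lt _ _ _ l e e'); transfer.
- move=> r g n i j i' j' x l e e'; apply: sepO => p.
  exists (face r i (conn g j (lift p _ x))); first by transfer.
  by rewrite (face_conn_gt _ _ _ l e e'); transfer.
- move=> n j k x e; apply: sepO => p.
  exists (src k (conn Neg j (lift p _ x))); first by transfer.
  by rewrite (src_conn_neg _ e); transfer.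
- move=> n j k x e; apply: sepO => p.
  exists (tgt k (conn Pos j (lift p _ x))); first by transfer.
  by rewrite (tgt_conn_pos _ e); transfer.
- move=> n j k x e; apply: sepO => p.
  exists (src k (conn Pos j (lift p _ x))); first by transfer.
  by rewrite (src_conn_pos _ e); transfer.
- move=> n j k x e; apply: sepO => p.
  exists (tgt k (conn Neg j (lift p _ x))); first by transfer.
  by rewrite (tgt_conn_neg _ e); transfer.
Defined.

Definition separated_magma : cubicalMagma.
Proof.
refine (@CubicalMagma separated_rcs (@op_pcomp X O) _ _ _ _).
- move=> n j a b h; apply: sepO => p.
  exists (src j (pcomp j _ _ (chom_composable (lift p) h))); first by transfer.
  by rewrite src_pcomp; transfer.
- move=> n j a b h; apply: sepO => p.
  exists (tgt j (pcomp j _ _ (chom_composable (lift p) h))); first by transfer.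
  by rewrite tgt_pcomp; transfer.
- move=> r n i j j' a b h h' l e; apply: sepO => p.
  exists (face r i (pcomp j _ _ (chom_composable (lift p) h)));
    first by transfer.
  by rewrite (face_pcomp_lt _ (lift_face_composable p h') l e); transfer.
- move=> r n i j j' a b h h' l e; apply: sepO => p.
  exists (face r i (pcomp j _ _ (chom_composable (lift p) h)));
    first by transfer.
  by rewrite (face_pcomp_gt _ (lift_face_composable p h') l e); transfer.
Defined.

Lemma separated_strict : is_strict separated_magma.
Proof.
split.
- move=> n j a b c hab habc hbc habc'; apply: sepO => p.
  have Hab := chom_composable (lift p) hab.
  have Hbc := chom_composable (lift p) hbc.
  have H : tgt j (pcomp j _ _ Hab) = src j (lift p _ c) by rewrite tgt_pcomp.
  have H' : tgt j (lift p _ a) = src j (pcomp j _ _ Hbc) by rewrite src_pcomp.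
  exists (pcomp j _ _ H); first by transfer.
  by rewrite (pcompA (probe_strict p) H H'); transfer.
- move=> n j a h; apply: sepO => p.
  exists (pcomp j _ _ (unitl_composable j (lift p _ a))); first by transfer.
  by rewrite (pcomp_unitl (probe_strict p)); transfer.
- move=> n j a h; apply: sepO => p.
  exists (pcomp j _ _ (unitr_composable j (lift p _ a))); first by transfer.
  by rewrite (pcomp_unitr (probe_strict p)); transfer.
- move=> n i j a b c d hab hcd hj hac hbd hi ne; apply: sepO => p.
  have Hab := chom_composable (lift p) hab.
  have Hcd := chom_composable (lift p) hcd.
  have Hac := chom_composable (lift p) hac.
  have Hbd := chom_composable (lift p) hbd.
  have Hj := pcomp_composable Hab Hcd ne Hac Hbd.
  have Hi := pcomp_composable Hac Hbd (not_eq_sym ne) Hab Hcd.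
  exists (pcomp j _ _ Hj); first by transfer.
  by rewrite (interchange (probe_strict p) Hj Hi ne); transfer.
- move=> n i j' j a b h h' l e; apply: sepO => p.
  have H := chom_composable (lift p) h.
  exists (refl i (pcomp j _ _ H)); first by transfer.
  by rewrite (refl_pcomp_le (probe_strict p) H
    (refl_composable_le l e H) l e); transfer.
- move=> n i j' j a b h h' l e; apply: sepO => p.
  have H := chom_composable (lift p) h.
  exists (refl i (pcomp j _ _ H)); first by transfer.
  by rewrite (refl_pcomp_gt (probe_strict p) H
    (refl_composable_gt l e H) l e); transfer.
- move=> g n i j j' a b h h' l e; apply: sepO => p.
  have H := chom_composable (lift p) h.
  exists (conn g i (pcomp j _ _ H)); first by transfer.
  by rewrite (conn_pcomp_lt (probe_strict p) H
    (conn_composable_lt g l e H) l e); transfer.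
- move=> g n i j j' a b h h' l e; apply: sepO => p.
  have H := chom_composable (lift p) h.
  exists (conn g i (pcomp j _ _ H)); first by transfer.
  by rewrite (conn_pcomp_gt (probe_strict p) H
    (conn_composable_gt g l e H) l e); transfer.
- move=> n j j0 j1 a b h h1 h2 h3 e0 e1; apply: sepO => p.
  have H := chom_composable (lift p) h.
  have H1 := conn_pos_refl_composable (lift p _ a) e0.
  have H2 := refl_conn_pos_composable e0 e1 H.
  have H3 := transport_pos_composable e0 e1 H (probe_strict p) H1 H2.
  exists (conn Pos j (pcomp j _ _ H)); first by transfer.
  by rewrite (transport_pos (probe_strict p) H H3 e0 e1); transfer.
- move=> n j j0 j1 a b h h1 h2 h3 e0 e1; apply: sepO => p.
  have H := chom_composable (lift p) h.
  have H1 := conn_neg_refl_composable e0 e1 H.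
  have H2 := refl_conn_neg_composable (lift p _ b) e0.
  have H3 := transport_neg_composable e0 e1 H (probe_strict p) H1 H2.
  exists (conn Neg j (pcomp j _ _ H)); first by transfer.
  by rewrite (transport_neg (probe_strict p) H H3 e0 e1); transfer.
- move=> n i i0 i1 x h e0 e1; apply: sepO => p.
  exists (pcomp i0 _ _ (conn_pos_neg_composable0 e0 (lift p _ x)));
    first by transfer.
  by rewrite (conn_pcomp0 (probe_strict p) _ e0 e1); transfer.
- move=> n i i0 i1 x h e0 e1; apply: sepO => p.
  exists (pcomp i1 _ _ (conn_pos_neg_composable1 e1 (lift p _ x)));
    first by transfer.
  by rewrite (conn_pcomp1 (probe_strict p) _ e0 e1); transfer.
Qed.

End Separated.

(** * The free strict category on a cubical set *)

Section Free.
Variable X : cubicalSet.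

(** Composites are allowed between arbitrary terms: whether the composition
    makes sense depends on equations that are only available after evaluation.
    Faces are formal operations for the same reason. *)
Inductive term : nat -> Type :=
| Gen n (x : X n) : term n
| Face (r : side) n (i : 'I_n.+1) (t : term n.+1) : term n
| Refl n (i : 'I_n.+1) (t : term n) : term n.+1
| Conn (g : sign) n (i : 'I_n) (t : term n) : term n.+1
| Comp n (j : 'I_n.+1) (t u : term n.+1) : term n.+1.

(** A relation rather than a function, since a term whose composites are not
    defined in [M] has no value. *)
Fixpoint value (M : cubicalMagma) (f : cubicalHom X M) n (t : term n) :
    M n -> Prop :=
  match t in term n return M n -> Prop with
  | Gen n x => fun m => m = f n x
  | Face r n i t => fun m => exists2 u, value f t u & m = face r i u
  | Refl n i t => fun m => exists2 u, value f t u & m = refl i u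
  | Conn g n i t => fun m => exists2 u, value f t u & m = conn g i u
  | Comp n j t u => fun m => exists a b (h : tgt j a = src j b),
      [/\ value f t a, value f u b & m = pcomp j a b h]
  end.

Lemma value_functional (M : cubicalMagma) (f : cubicalHom X M) n (t : term n)
    m m' :
  value f t m -> value f t m' -> m = m'.
Proof.
elim: t m m' => {n} /=
  [n x|r n i t IH|n i t IH|g n i t IH|n j t IHt u IHu] m m'.
- by move=> -> ->.
- by move=> [a ha ->] [b hb ->]; rewrite (IH _ _ ha hb).
- by move=> [a ha ->] [b hb ->]; rewrite (IH _ _ ha hb).
- by move=> [a ha ->] [b hb ->]; rewrite (IH _ _ ha hb).
- move=> [a [b [h [ha hb ->]]]] [a' [b' [h' [ha' hb' ->]]]].
  by apply: pcomp_congr; [exact: IHt ha ha' | exact: IHu hb hb'].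
Qed.

Lemma value_morph (M N : cubicalMagma) (g : magmaHom M N) (f : cubicalHom X M)
    n (t : term n) m :
  value f t m -> value (cubical_comp g f) t (g n m).
Proof.
elim: t m => {n} /= [n x|r n i t IH|n i t IH|s n i t IH|n j t IHt u IHu] m.
- by move->.
- by move=> [a /IH ha ->]; exists (g _ a) => //; rewrite chom_face.
- by move=> [a /IH ha ->]; exists (g _ a) => //; rewrite mhom_refl.
- by move=> [a /IH ha ->]; exists (g _ a) => //; rewrite mhom_conn.
- move=> [a [b [h [/IHt ha /IHu hb ->]]]].
  have h' : tgt j (g _ a) = src j (g _ b) by exact: chom_composable.
  by exists (g _ a), (g _ b), h'; split=> //; rewrite (mhom_pcomp h h').
Qed.

(** The relation [same t t] holds when [t] has a value in every strict
    category under [X].  As [Prop] is impredicative, quantifying over all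
    strict categories does not raise the universe level of the quotient, which
    avoids the size problem of cutting the free category out of a product
    indexed by all maps from [X] to strict categories. *)
Definition same n (t u : term n) : Prop :=
  forall (M : cubicalMagma) (f : cubicalHom X M), is_strict M ->
    exists2 m, value f t m & value f u m.

(** Cells are classes of terms, each class given by its membership predicate
    so that equal classes are equal cells. *)
Record free_cell n := FreeCell {
  class : term n -> Prop;
  classP : exists2 t, same t t & class = same t }.

Definition rep n (c : free_cell n) : term n := s2val (cid2 (classP c)).

Lemma rep_defined n (c : free_cell n) : same (rep c) (rep c).
Proof. by rewrite /rep; case: cid2. Qed.

Lemma class_rep n (c : free_cell n) : class c = same (rep c).
Proof. by rewrite /rep; case: cid2. Qed.

Definition quo n (t : term n) (d : same t t) : free_cell n :=
  @FreeCell n (same t)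
    (ex_intro2 (fun u => same u u) (fun u => same t = same u) t d erefl).

Section Eval.
Variables (M : cubicalMagma) (sM : is_strict M) (f : cubicalHom X M).

Lemma eval_subproof n (c : free_cell n) : exists m, value f (rep c) m.
Proof. by have [m hm _] := rep_defined c f sM; exists m. Qed.

Definition eval n (c : free_cell n) : M n := sval (cid (eval_subproof c)).

Lemma value_eval n (c : free_cell n) : value f (rep c) (eval c).
Proof. by rewrite /eval; case: cid. Qed.

Lemma eval_quo n (t : term n) (d : same t t) m :
  value f t m -> eval (quo d) = m.
Proof.
move=> hm; have : same t (rep (quo d)).
  rewrite -[same t]/(class (quo d)) class_rep; exact: rep_defined.
case/(_ M f sM) => u hu hu'.
by rewrite (value_functional (value_eval _) hu') (value_functional hm hu).
Qed.

End Eval.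

(** Two cells with the same evaluations have representatives with the same
    values, which are thus members of the same class. *)
Lemma eval_inj n (c d : free_cell n) :
  (forall (M : cubicalMagma) (sM : is_strict M) (f : cubicalHom X M),
     eval sM f c = eval sM f d) -> c = d.
Proof.
move=> e; have : class c = class d.
  rewrite !class_rep; apply/funext => t; apply/propext.
  have sub : forall c d : free_cell n,
      (forall (M : cubicalMagma) (sM : is_strict M) (f : cubicalHom X M),
       eval sM f c = eval sM f d) -> same (rep c) t -> same (rep d) t.
    move=> {e}c {}d e hc M f sM; have [m hm hm'] := hc M f sM.
    exists m => //.
    rewrite -(value_functional (value_eval sM f c) hm) e; exact: value_eval.
  by split; apply: sub.
case: c d {e} => [c cP] [d dP] /= e; subst d.
by congr FreeCell; exact: Prop_irrelevance.
Qed.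

Lemma gen_defined n (x : X n) : same (Gen x) (Gen x).
Proof. by move=> M f sM; exists (f n x). Qed.

Lemma face_defined r n (i : 'I_n.+1) (c : free_cell n.+1) :
  same (Face r i (rep c)) (Face r i (rep c)).
Proof.
by move=> M f sM; exists (face r i (eval sM f c)); exists (eval sM f c) => //;
  exact: value_eval.
Qed.

Lemma refl_defined n (i : 'I_n.+1) (c : free_cell n) :
  same (Refl i (rep c)) (Refl i (rep c)).
Proof.
by move=> M f sM; exists (refl i (eval sM f c)); exists (eval sM f c) => //;
  exact: value_eval.
Qed.

Lemma conn_defined g n (i : 'I_n) (c : free_cell n) :
  same (Conn g i (rep c)) (Conn g i (rep c)).
Proof.
by move=> M f sM; exists (conn g i (eval sM f c)); exists (eval sM f c) => //;
  exact: value_eval.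
Qed.

Definition free_face r n (i : 'I_n.+1) (c : free_cell n.+1) : free_cell n :=
  quo (face_defined r i c).

Lemma eval_face (M : cubicalMagma) (sM : is_strict M) (f : cubicalHom X M)
    r n (i : 'I_n.+1) (c : free_cell n.+1) :
  eval sM f (free_face r i c) = face r i (eval sM f c).
Proof.
by apply: eval_quo; exists (eval sM f c) => //; exact: value_eval.
Qed.

Lemma free_face_face (a b : side) n (i j : 'I_n.+2) (i' j' : 'I_n.+1)
    (x : free_cell n.+2) :
  i < j -> i' = i :> nat -> j = j'.+1 :> nat ->
  free_face a i' (free_face b j x) = free_face b j' (free_face a i x).
Proof.
move=> l e e'; apply: eval_inj => M sM f.
by rewrite !eval_face (face_face a b _ l e e').
Qed.

Definition free_cset : cubicalSet := CubicalSet free_face_face.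

Lemma eval_composable (M : cubicalMagma) (sM : is_strict M)
    (f : cubicalHom X M) n (j : 'I_n.+1) (c d : free_cset n.+1) :
  tgt j c = src j d -> tgt j (eval sM f c) = src j (eval sM f d).
Proof. by move=> h; rewrite -!eval_face; congr eval. Qed.

Lemma comp_defined n (j : 'I_n.+1) (c d : free_cset n.+1)
    (h : tgt j c = src j d) :
  same (Comp j (rep c) (rep d)) (Comp j (rep c) (rep d)).
Proof.
move=> M f sM; have h' := eval_composable sM f h.
by exists (pcomp j _ _ h') => /=; exists (eval sM f c), (eval sM f d), h';
  split=> //; exact: value_eval.
Qed.

Definition free_ops : cubicalOps free_cset :=
  @CubicalOps free_cset (fun n i c => quo (refl_defined i c))
    (fun g n i c => quo (conn_defined g i c))
    (fun n j c d h => quo (comp_defined h)).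

Lemma eval_refl (M : cubicalMagma) (sM : is_strict M) (f : cubicalHom X M)
    n (i : 'I_n.+1) (c : free_cset n) :
  eval sM f (op_refl free_ops i c) = refl i (eval sM f c).
Proof.
by apply: eval_quo; exists (eval sM f c) => //; exact: value_eval.
Qed.

Lemma eval_conn (M : cubicalMagma) (sM : is_strict M) (f : cubicalHom X M)
    g n (i : 'I_n) (c : free_cset n) :
  eval sM f (op_conn free_ops g i c) = conn g i (eval sM f c).
Proof.
by apply: eval_quo; exists (eval sM f c) => //; exact: value_eval.
Qed.

Lemma eval_pcomp (M : cubicalMagma) (sM : is_strict M) (f : cubicalHom X M)
    n (j : 'I_n.+1) (c d : free_cset n.+1) (h : tgt j c = src j d) h' :
  eval sM f (op_pcomp free_ops h) = pcomp j (eval sM f c) (eval sM f d) h'.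
Proof.
by apply: eval_quo; exists (eval sM f c), (eval sM f d), h';
  split=> //; exact: value_eval.
Qed.

Definition eval_chom (M : cubicalMagma) (sM : is_strict M)
    (f : cubicalHom X M) : cubicalHom free_cset M :=
  @CubicalHom free_cset M (eval sM f) (eval_face sM f).

Definition eval_probe (M : cubicalMagma) (sM : is_strict M)
    (f : cubicalHom X M) : probe free_ops.
Proof.
refine (@Probe free_cset free_ops M sM (eval_chom sM f)
  (fun n m c => eval sM f c = m) _ _ _ _ _) => //.
- by move=> r n i m c <-; rewrite -eval_face.
- by move=> n i m c <-; rewrite -eval_refl.
- by move=> g n i m c <-; rewrite -eval_conn.
- by move=> n j u v c d h h' eu ev; subst u v; exact: eval_pcomp.
Defined.

Lemma free_separated : separated free_ops.
Proof.
move=> n c d e; apply: eval_inj => M sM f.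
by have [m /= -> ->] := e (eval_probe sM f).
Qed.

Definition free_magma : cubicalMagma := separated_magma free_separated.

Lemma free_strict : is_strict free_magma.
Proof. exact: separated_strict. Qed.

Definition gen n (x : X n) : free_magma n := quo (gen_defined x).

Lemma eval_gen (M : cubicalMagma) (sM : is_strict M) (f : cubicalHom X M)
    n (x : X n) :
  eval sM f (gen x) = f n x.
Proof. exact: eval_quo. Qed.

Lemma gen_face r n (i : 'I_n.+1) (x : X n.+1) :
  gen (face r i x) = face r i (gen x).
Proof.
apply: eval_inj => M sM f.
by rewrite eval_face !eval_gen chom_face.
Qed.

Definition gen_hom : cubicalHom X free_magma :=
  @CubicalHom X free_magma gen gen_face.

(** The existence half of the universal property. *)
Definition extend (M : cubicalMagma) (sM : is_strict M) (f : cubicalHom X M) :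
    magmaHom free_magma M.
Proof.
refine (@MagmaHom free_magma M (eval_chom sM f) _ _ _).
- exact: eval_refl.
- exact: eval_conn.
- exact: eval_pcomp.
Defined.

Lemma extend_gen (M : cubicalMagma) (sM : is_strict M) (f : cubicalHom X M)
    n (x : X n) :
  extend sM f n (gen x) = f n x.
Proof. exact: eval_gen. Qed.

(** Every cell is obtained from generators by the operations.  No induction on
    terms is needed: the free category is itself a strict category under [X],
    so the representative of [c] has some value [c'] in it, and since
    evaluations are morphisms, [c'] and [c] have the same evaluations. *)
Lemma value_gen n (c : free_magma n) : value gen_hom (rep c) c.
Proof.
have [c' hc' _] := rep_defined c gen_hom free_strict.
suff e : c' = c by rewrite e in hc'.
apply: eval_inj => M sM f.
have := value_morph (extend sM f) hc'.
have -> : cubical_comp (extend sM f) gen_hom = f.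
  by apply: cubicalHom_eq => k x; exact: extend_gen.
by move=> h; exact: value_functional h (value_eval sM f c).
Qed.

(** Two morphisms send [c] to values of the same term under the same map on
    generators. *)
Lemma extend_unique (M : cubicalMagma) (g h : magmaHom free_magma M) :
  (forall n (x : X n), g n (gen x) = h n (gen x)) -> g = h.
Proof.
move=> e; apply: magmaHom_eq => n c.
apply: (@value_functional M (cubical_comp g gen_hom) n (rep c)).
  exact: value_morph (value_gen c).
have -> : cubical_comp g gen_hom = cubical_comp h gen_hom.
  by apply: cubicalHom_eq => k x; exact: e.
exact: value_morph (value_gen c).
Qed.

End Free.

(** * The adjunction *)

Lemma chom_congr (A B : cubicalSet) (f g : cubicalHom A B) n (x : A n) :
  f = g -> f n x = g n x.
Proof. by move->. Qed.

Definition free_ob (X : cubicalSet) : infCCAT :=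
  exist is_strict (free_magma X) (@free_strict X).

Definition free_map (X Y : cubicalSet) (f : cubicalHom X Y) :
    magmaHom (free_magma X) (free_magma Y) :=
  extend (@free_strict Y) (cubical_comp (gen_hom Y) f).

Lemma free_map1 (X : cubicalSet) :
  free_map (cubical_id X) = magma_id (free_magma X).
Proof. by apply: extend_unique => n x; rewrite extend_gen. Qed.

Lemma free_mapM (X Y Z : cubicalSet) (g : cubicalHom Y Z) (f : cubicalHom X Y) :
  free_map (cubical_comp g f) = magma_comp (free_map g) (free_map f).
Proof.
by apply: extend_unique => n x /=; rewrite !(eval_gen, extend_gen) /= ?eval_gen.
Qed.

Definition free_functor : functor CSets infCCAT :=
  @Functor CSets infCCAT free_ob free_map free_map1 free_mapM.

Lemma gen_natural (X Y : cubicalSet) (f : cubicalHom X Y) :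
  cubical_comp (gen_hom Y) f = cubical_comp (free_map f) (gen_hom X).
Proof. by apply: cubicalHom_eq => n x /=; rewrite eval_gen. Qed.

Definition free_unit :
    nattrans (id_functor CSets) (comp_functor forgetful free_functor) :=
  @Nattrans CSets CSets (id_functor CSets) (comp_functor forgetful free_functor)
    gen_hom gen_natural.

Definition counit (M : infCCAT) : magmaHom (free_magma (sval M)) (sval M) :=
  extend (svalP M) (cubical_id (sval M)).

Lemma counit_natural (M N : infCCAT) (f : hom M N) :
  magma_comp (counit N) (free_map (mag_chom f)) = magma_comp f (counit M).
Proof.
by apply: extend_unique => n x /=; rewrite !(eval_gen, extend_gen) /= ?eval_gen.
Qed.

Definition free_counit :
    nattrans (comp_functor free_functor forgetful) (id_functor infCCAT) :=
  @Nattrans infCCAT infCCAT (comp_functor free_functor forgetful)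
    (id_functor infCCAT) counit counit_natural.

Definition free_adjunction : adjunction free_functor forgetful.
Proof.
refine (@Adjunction CSets infCCAT free_functor forgetful free_unit free_counit
  _ _).
- by move=> X; apply: extend_unique => n x /=; rewrite eval_gen /= eval_gen.
- by move=> M; apply: cubicalHom_eq => n x /=; rewrite eval_gen.
Defined.

(** * From algebras to strict categories *)

Notation free_monad := (adj_monad free_adjunction).

Section AlgebraCategory.
Variable A : algebra free_monad.

Let X : cubicalSet := alg_car A.
Let act : cubicalHom (free_magma X) X := alg_act A.

Lemma act_gen n (x : X n) : act n (gen x) = x.
Proof. exact: (chom_congr x (alg_unit A)). Qed.

Lemma act_counit n (y : free_magma (free_magma X) n) :
  act n (counit (free_ob X) n y) = act n (free_map act n y).
Proof. exact: (esym (chom_congr y (alg_assoc A))). Qed.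

Definition act_ops : cubicalOps X :=
  @CubicalOps X (fun n i x => act _ (refl i (gen x)))
    (fun g n i x => act _ (conn g i (gen x)))
    (fun n j a b h => act _ (pcomp j _ _ (chom_composable (gen_hom X) h))).

(** Apply [act_counit] to the cell of the free category on the free category
    obtained by performing the operation on generators: the counit turns it
    into the operation on [c], and [free_map act] into the operation on
    [gen (act c)].  The other operations are treated alike. *)
Lemma act_refl n (i : 'I_n.+1) (c : free_magma X n) :
  act _ (refl i c) = op_refl act_ops i (act _ c).
Proof.
have := act_counit (refl i (gen c : free_magma (free_magma X) n)).
by rewrite !mhom_refl !extend_gen.
Qed.

Lemma act_conn g n (i : 'I_n) (c : free_magma X n) :
  act _ (conn g i c) = op_conn act_ops g i (act _ c).
Proof.
have := act_counit (conn g i (gen c : free_magma (free_magma X) n)).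
by rewrite !mhom_conn !extend_gen.
Qed.

Lemma act_pcomp n (j : 'I_n.+1) (c d : free_magma X n.+1) h
    (h' : tgt j (act _ c) = src j (act _ d)) :
  act _ (pcomp j c d h) = op_pcomp act_ops h'.
Proof.
have h0 : tgt j (gen c : free_magma (free_magma X) n.+1) = src j (gen d).
  exact: (chom_composable (gen_hom _) h).
have := act_counit (pcomp j _ _ h0).
rewrite (mhom_pcomp _ (chom_composable _ h0)).
rewrite (mhom_pcomp _ (chom_composable _ h0)) /=.
move=> e; etransitivity; last (etransitivity; first exact: e).
  by congr (act _ _); apply: pcomp_congr; rewrite eval_gen.
by congr (act _ _); apply: pcomp_congr; rewrite eval_gen.
Qed.

(** The probe is the free category, through which [X] splits by [act_gen]. *)
Definition act_probe : probe act_ops.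
Proof.
refine (@Probe X act_ops (free_magma X) (@free_strict X) (gen_hom X)
  (fun n m x => act n m = x) _ _ _ _ _).
- exact: act_gen.
- by move=> r n i m x <-; rewrite chom_face.
- by move=> n i m x <-; exact: act_refl.
- by move=> g n i m x <-; exact: act_conn.
- by move=> n j u v a b h h' eu ev; subst a b; exact: act_pcomp.
Defined.

Lemma act_separated : separated act_ops.
Proof. by move=> n x y e; have [m /= -> ->] := e act_probe. Qed.

Definition alg_magma : cubicalMagma := separated_magma act_separated.

Definition alg_ob : infCCAT :=
  exist is_strict alg_magma (separated_strict act_separated).

Definition act_hom : magmaHom (free_magma X) alg_magma :=
  @MagmaHom (free_magma X) alg_magma act act_refl act_conn act_pcomp.

(** Both sides are morphisms out of a free category that send each generator
    to its underlying cell. *)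
Lemma counit_alg_ob : counit alg_ob = act_hom.
Proof. by apply: extend_unique => n x; rewrite extend_gen /= act_gen. Qed.

End AlgebraCategory.

Section AlgebraMap.
Variables (A B : algebra free_monad) (f : alg_hom A B).

Let g : cubicalHom (alg_car A) (alg_car B) := alg_map f.

Lemma alg_map_act n (c : free_magma (alg_car A) n) :
  g n (alg_act A n c) = alg_act B n (free_map g n c).
Proof. exact: (chom_congr c (alg_mapP f)). Qed.

Definition alg_magma_map : magmaHom (alg_magma A) (alg_magma B).
Proof.
refine (@MagmaHom (alg_magma A) (alg_magma B) g _ _ _).
- move=> n i x; have := alg_map_act (refl i (gen x)).
  by rewrite mhom_refl extend_gen.
- move=> s n i x; have := alg_map_act (conn s i (gen x)).
  by rewrite mhom_conn extend_gen.
- move=> n j a b h h'.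
  have := alg_map_act (pcomp j _ _ (chom_composable (gen_hom _) h)).
  rewrite (mhom_pcomp _ (chom_composable _ (chom_composable (gen_hom _) h))).
  move=> e; etransitivity; first exact: e.
  by congr (alg_act B _ _); apply: pcomp_congr; rewrite extend_gen.
Defined.

End AlgebraMap.

(** * The comparison functor is an equivalence *)

Lemma alg_magma_map1 (A : EM_category free_monad) :
  alg_magma_map (idm A) = magma_id (alg_magma A).
Proof. exact: magmaHom_eq. Qed.

Lemma alg_magma_mapM (A B C : EM_category free_monad)
    (g : hom B C) (f : hom A B) :
  alg_magma_map (g ∘ f) = magma_comp (alg_magma_map g) (alg_magma_map f).
Proof. exact: magmaHom_eq. Qed.

Definition alg_functor : functor (EM_category free_monad) infCCAT :=
  @Functor (EM_category free_monad) infCCAT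
    alg_ob alg_magma_map alg_magma_map1 alg_magma_mapM.

Notation comparison := (comparison_functor free_adjunction).

Section ComparisonUnit.
Variable M : infCCAT.

(** The operations that [M] induces on itself through its algebra are its own,
    as the counit is a morphism and sends generators to their cells.
    Hence the identity maps below are morphisms of categories. *)
Lemma counit_pcomp n (j : 'I_n.+1) (a b : sval M n.+1) H h :
  counit M n.+1 (pcomp j (gen a) (gen b) H) = pcomp j a b h.
Proof.
rewrite (mhom_pcomp H (chom_composable (counit M) H)).
by apply: pcomp_congr; rewrite extend_gen.
Qed.

Definition comparison_unit : magmaHom (sval M) (alg_magma (comparison M)).
Proof.
refine (@MagmaHom (sval M) (alg_magma (comparison M)) (cubical_id (sval M))
  _ _ _).
- by move=> n i x /=; rewrite eval_refl eval_gen.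
- by move=> g n i x /=; rewrite eval_conn eval_gen.
- by move=> n j a b h h'; exact: esym (counit_pcomp _ h).
Defined.

Definition comparison_unit_inv : magmaHom (alg_magma (comparison M)) (sval M).
Proof.
refine (@MagmaHom (alg_magma (comparison M)) (sval M) (cubical_id (sval M))
  _ _ _).
- by move=> n i x /=; rewrite eval_refl eval_gen.
- by move=> g n i x /=; rewrite eval_conn eval_gen.
- by move=> n j a b h h'; exact: counit_pcomp _ h'.
Defined.
End ComparisonUnit.

Definition comparison_unit_nat :
    nattrans (id_functor infCCAT) (comp_functor alg_functor comparison).
Proof.
refine (@Nattrans infCCAT infCCAT (id_functor infCCAT)
  (comp_functor alg_functor comparison) comparison_unit _).
by move=> M N f; apply: magmaHom_eq.
Defined.

Section ComparisonCounit.
Variable A : algebra free_monad.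

(** The two algebras have the same carrier and the same action, so the
    identity is a morphism between them in both directions. *)
Lemma comparison_act : alg_act (comparison (alg_ob A)) = alg_act A.
Proof. exact: (congr1 (@mag_chom _ _) (counit_alg_ob A)). Qed.

Definition comparison_counit : alg_hom (comparison (alg_ob A)) A.
Proof.
refine (@AlgHom _ _ (comparison (alg_ob A)) A (cubical_id (alg_car A)) _).
by rewrite comparison_act; exact: alg_idP A.
Defined.

Definition comparison_counit_inv : alg_hom A (comparison (alg_ob A)).
Proof.
refine (@AlgHom _ _ A (comparison (alg_ob A)) (cubical_id (alg_car A)) _).
by rewrite comparison_act; exact: alg_idP A.
Defined.

End ComparisonCounit.

Definition comparison_counit_nat :
    nattrans (comp_functor comparison alg_functor)
      (id_functor (EM_category free_monad)).
Proof.
refine (@Nattrans _ _ (comp_functor comparison alg_functor)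
  (id_functor _) comparison_counit _).
by move=> A B f; apply: alg_hom_eq; apply: cubicalHom_eq.
Defined.

Theorem proposition1 : is_right_adjoint forgetful /\ is_monadic forgetful.
Proof.
split; first by exists free_functor; exact: inhabits free_adjunction.
exists free_functor, free_adjunction, alg_functor; split.
- exists comparison_unit_nat => M; exists (comparison_unit_inv M).
  by split; apply: magmaHom_eq.
- exists comparison_counit_nat => A; exists (comparison_counit_inv A).
  by split; apply: alg_hom_eq; apply: cubicalHom_eq.
Qed.
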